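(* Let $\mathcal Q(\mathbb R)=\{(z,w)\in\mathbb C^2:2\,\mathrm{Re}\,z-|w|^2=0\}$, endowed with the Lie group law $(z,w)\cdot(z',w')=(z+z'+w'\bar w,\,w+w')$, and let $\mathcal Q(\mathbb Q)=\mathcal Q(\mathbb R)\cap\mathbb Q(i)^2$. For $r=(p/q,p'/q)\in\mathcal Q(\mathbb Q)$ with $p,p',q\in\mathbb Z[i]$ relatively prime, let $h(r)=|q|$. Let $d'_{\mathrm{Cyg}}$ be the left-invariant distance on $\mathcal Q(\mathbb R)$ such that $d'_{\mathrm{Cyg}}((z,w),(0,0))=\sqrt{2|z|+|w|^2}$. For every $x\in\mathcal Q(\mathbb R)-\mathcal Q(\mathbb Q)$, let $$c(x)=\liminf_{r\in\mathcal Q(\mathbb Q),\ h(r)\to\infty}h(r)\,d'_{\mathrm{Cyg}}(x,r),$$ and let $\mathrm{Sp}_{\mathrm{Lag}}$ be the set of real numbers of the form $c(x)$ for some $x\in\mathcal Q(\mathbb R)-\mathcal Q(\mathbb Q)$. Then $\mathrm{Sp}_{\mathrm{Lag}}$ contains the interval $[0,0.047]$. *)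

(* Defs.v *)
From Stdlib Require Import Reals ZArith.
From Coquelicot Require Import Coquelicot.
Open Scope R_scope.

Definition pt : Type := (C * C)%type.

Definition in_QR (x : pt) : Prop :=
  2 * Re (fst x) - (Cmod (snd x))^2 = 0.

Definition cyg_mul (x y : pt) : pt :=
  (Cplus (Cplus (fst x) (fst y)) (Cmult (snd y) (Cconj (snd x))),
   Cplus (snd x) (snd y)).

Definition cyg_inv (x : pt) : pt :=
  (Cminus (RtoC ((Cmod (snd x))^2)) (fst x), Copp (snd x)).

Definition cyg_gauge (x : pt) : R :=
  sqrt (2 * Cmod (fst x) + (Cmod (snd x))^2).

Definition dCyg (x y : pt) : R := cyg_gauge (cyg_mul (cyg_inv x) y).

Definition is_gauss_int (z : C) : Prop :=
  exists a b : Z, z = (IZR a, IZR b).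

Definition gdivides (d p : C) : Prop :=
  exists k, is_gauss_int k /\ p = Cmult d k.

Definition gunit (u : C) : Prop := is_gauss_int u /\ Cmod u = 1.

Definition gcoprime3 (p p' q : C) : Prop :=
  forall d, is_gauss_int d -> gdivides d p -> gdivides d p' -> gdivides d q ->
    gunit d.

Definition is_gauss_rat (z : C) : Prop :=
  exists p q, is_gauss_int p /\ is_gauss_int q /\ q <> RtoC 0 /\ z = Cdiv p q.

Definition in_QQ (x : pt) : Prop :=
  in_QR x /\ is_gauss_rat (fst x) /\ is_gauss_rat (snd x).

Definition height (r : pt) (h : R) : Prop :=
  exists p p' q, is_gauss_int p /\ is_gauss_int p' /\ is_gauss_int q /\
    q <> RtoC 0 /\ gcoprime3 p p' q /\
    fst r = Cdiv p q /\ snd r = Cdiv p' q /\ h = Cmod q.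

(* c(x) = liminf_{r in Q(Q), h(r) -> oo} h(r) d'_Cyg(x, r)
        = sup_H inf { h(r) d(x,r) : r in Q(Q), h(r) >= H }  (in Rbar) *)
Definition c_lag (x : pt) : Rbar :=
  Lub_Rbar (fun y : R => exists H : R,
    Finite y = Glb_Rbar (fun v : R => exists r hr,
      in_QQ r /\ height r hr /\ H <= hr /\ v = hr * dCyg x r)).

Definition Sp_Lag (t : R) : Prop :=
  exists x : pt, in_QR x /\ ~ in_QQ x /\ c_lag x = Finite t.

(* Main.v *)
(** On the vertical chain w = 0 put x = (i s, 0).  For r = (p/q, p'/q) the
    quantity h(r)^2 d'(x, r)^2 equals 2 |q|^2 |p/q - i s| + |p'|^2, which is at
    least 1 when p' <> 0, while p' = 0 forces r = (i a/b, 0) and the value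
    2 b |b s - a|.  So c(x)^2 is twice the classical Lagrange constant of s as
    soon as this is at most 1, and it suffices to have Hall's ray for large
    values: every M >= 905 is the limsup of
    a_n + [0; a_{n+1}, a_{n+2}, ...] + [0; a_{n-1}, ..., a_0]
    for some digits a_n.  Following Hall, every u in an interval of length
    greater than 1 is a sum of two continued fractions with digits at most 10;
    taking u = M - m, the digits are blocks "first digits of the second
    fraction reversed, m, first digits of the first fraction", of growing
    precision.  At the other positions the sum is at most 12. *)

Require Import Defs.
From Stdlib Require Import Reals.
From Coquelicot Require Import Coquelicot.
From Stdlib Require Import ZArith List Lra Lia Psatz IndefiniteDescription.
Import ListNotations.
Open Scope R_scope.

(** * Finite continued fractions and continuants *)

(** This is [0; d1, ..., dk + x]. The remainder [x] stands for all that follows the word, so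
    evaluation composes along concatenation. *)
Fixpoint ev (w : list Z) (x : R) : R :=
  match w with
  | [] => x
  | d :: w' => / (IZR d + ev w' x)
  end.

(* Continuants of a word listed with its most recent digit first: [cont] started at (0, 1) and (1, 0)
   gives the last two numerators and denominators, the primes denoting the earlier ones. *)
Fixpoint cont (s : Z * Z) (w : list Z) : Z * Z :=
  match w with
  | [] => s
  | d :: w' => ((d * fst (cont s w') + snd (cont s w'))%Z, fst (cont s w'))
  end.

Definition num (w : list Z) : R := IZR (fst (cont (0, 1)%Z w)).
Definition num' (w : list Z) : R := IZR (snd (cont (0, 1)%Z w)).
Definition den (w : list Z) : R := IZR (fst (cont (1, 0)%Z w)).
Definition den' (w : list Z) : R := IZR (snd (cont (1, 0)%Z w)).

Definition all_pos (w : list Z) : Prop := Forall (fun d => 1 <= d)%Z w.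

Lemma num_cons d w : num (d :: w) = IZR d * num w + num' w.
Proof. unfold num, num'. simpl. now rewrite plus_IZR, mult_IZR. Qed.

Lemma num'_cons d w : num' (d :: w) = num w.
Proof. reflexivity. Qed.

Lemma den_cons d w : den (d :: w) = IZR d * den w + den' w.
Proof. unfold den, den'. simpl. now rewrite plus_IZR, mult_IZR. Qed.

Lemma den'_cons d w : den' (d :: w) = den w.
Proof. reflexivity. Qed.

Lemma den_bounds w : all_pos w -> 1 <= den w /\ 0 <= den' w <= den w.
Proof.
  induction 1 as [|d w Hd Hw IH].
  - unfold den, den'; simpl; lra.
  - rewrite den_cons, den'_cons. apply IZR_le in Hd. nra.
Qed.

(** Each new digit adds at least [den' w], which is at least 1 once [w] is nonempty. This linear
    growth is all that the convergence arguments use. *)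
Lemma den_ge_length w : all_pos w ->
  INR (length w) <= den w /\ INR (length w) <= 1 + den' w.
Proof.
  induction 1 as [|d w Hd Hw IH].
  - unfold den, den'; simpl; lra.
  - rewrite den_cons, den'_cons. change (length (d :: w)) with (S (length w)).
    rewrite S_INR. apply IZR_le in Hd. pose proof (den_bounds w Hw).
    assert (den w <= IZR d * den w) by nra. destruct w as [|d' w].
    + unfold den, den' in *; simpl in *; lra.
    + pose proof (den_bounds w (Forall_inv_tail Hw)). rewrite den'_cons in *. lra.
Qed.

(** A new digit multiplies the matrix of continuants by a matrix of determinant -1. *)
Lemma det_step d w :
  num' (d :: w) * den (d :: w) - num (d :: w) * den' (d :: w) =
  - (num' w * den w - num w * den' w).
Proof. rewrite num_cons, num'_cons, den_cons, den'_cons. ring. Qed.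

Lemma det_unit w : Rabs (num' w * den w - num w * den' w) = 1.
Proof.
  induction w as [|d w IH].
  - unfold num, num', den, den'; simpl. replace (1 * 1 - 0 * 0) with 1 by ring. apply Rabs_R1.
  - now rewrite det_step, Rabs_Ropp.
Qed.

Lemma ev_nonneg w x : all_pos w -> 0 <= x -> 0 <= ev w x.
Proof.
  induction 1 as [|d w Hd Hw IH]; simpl; intros Hx; auto.
  apply IZR_le in Hd. specialize (IH Hx).
  apply Rlt_le, Rinv_0_lt_compat. lra.
Qed.

Lemma ev_le1 w x : all_pos w -> 0 <= x <= 1 -> 0 <= ev w x <= 1.
Proof.
  intros Hw Hx. split; [apply ev_nonneg; tauto|].
  destruct Hw as [|d w Hd Hw]; simpl; [lra|].
  apply IZR_le in Hd. pose proof (ev_nonneg w x Hw (proj1 Hx)).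
  rewrite <- Rinv_1. apply Rinv_le_contravar; lra.
Qed.

Lemma ev_app w1 w2 x : ev (w1 ++ w2) x = ev w1 (ev w2 x).
Proof. induction w1 as [|d w1 IH]; simpl; congruence. Qed.

(** Continuants take the most recent digit first and [ev] the outermost one, whence [rev]. The word
    acts as a Möbius map on the remainder. *)
Lemma ev_rev w x : all_pos w -> 0 <= x ->
  ev (rev w) x = (num w + num' w * x) / (den w + den' w * x).
Proof.
  intros Hw; revert x; induction Hw as [|d w Hd Hw IH]; intros x Hx.
  - unfold num, num', den, den'; simpl. field.
  - simpl rev. rewrite ev_app. simpl ev.
    apply IZR_le in Hd. pose proof (den_bounds w Hw).
    rewrite IH by (apply Rlt_le, Rinv_0_lt_compat; lra).
    rewrite num_cons, num'_cons, den_cons, den'_cons.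
    field. split; [|lra]. nra.
Qed.

(** The mirror formula: dividing the recurrence of the denominators by [den w] unfolds the digits
    backwards in time. *)
Lemma ev_nil_den w : all_pos w -> ev w 0 = den' w / den w.
Proof.
  induction 1 as [|d w Hd Hw IH].
  - unfold den, den'; simpl; field.
  - simpl. rewrite IH, den_cons, den'_cons. apply IZR_le in Hd.
    pose proof (den_bounds w Hw). field. split; nra.
Qed.

(* Value of the continued fraction with digits [rev w] followed by the complete quotient [t]. *)
Definition psi (w : list Z) (t : R) : R := (num w * t + num' w) / (den w * t + den' w).

Lemma psi_cons d w t : all_pos w -> (1 <= d)%Z -> 0 < t ->
  psi (d :: w) t = psi w (IZR d + / t).
Proof.
  intros Hw Hd Ht. unfold psi. apply IZR_le in Hd.
  rewrite num_cons, num'_cons, den_cons, den'_cons.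
  pose proof (den_bounds w Hw). assert (0 < IZR d * t) by nra.
  field. split; [|nra]. nra.
Qed.

Lemma psi_sub w t t' : all_pos w -> 0 < t -> 0 < t' ->
  psi w t - psi w t' =
  (num' w * den w - num w * den' w) * (t' - t)
    / ((den w * t + den' w) * (den w * t' + den' w)).
Proof.
  intros Hw Ht Ht'. unfold psi. pose proof (den_bounds w Hw).
  field. split; nra.
Qed.

Lemma psi_dist w t t' : all_pos w -> 0 < t -> 0 < t' ->
  Rabs (psi w t - psi w t') =
  Rabs (t' - t) / ((den w * t + den' w) * (den w * t' + den' w)).
Proof.
  intros Hw Ht Ht'. rewrite psi_sub by auto. pose proof (den_bounds w Hw).
  unfold Rdiv. rewrite !Rabs_mult, det_unit, Rmult_1_l. f_equal.
  apply Rabs_pos_eq, Rlt_le, Rinv_0_lt_compat, Rmult_lt_0_compat; nra.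
Qed.

(** * Sums of continued fractions with digits at most 10 *)

(* [alpha] = [0; 10, 1, 10, 1, ...] and [beta] = [0; 1, 10, 1, 10, ...] are the extreme values. *)
Definition alpha : R := (sqrt 35 - 5) / 10.
Definition beta : R := / (1 + alpha).

Lemma alpha_bounds : 9 / 100 < alpha < 92 / 1000.
Proof.
  unfold alpha.
  assert (H : sqrt 35 * sqrt 35 = 35) by (apply sqrt_sqrt; lra).
  pose proof (sqrt_pos 35). split; nra.
Qed.

Lemma alpha_eq : alpha = / (10 + beta).
Proof.
  (* The quadratic equation that expresses the periodicity of [0; 10, 1, 10, 1, ...]. *)
  assert (H : 10 * alpha * (1 + alpha) = 1).
  { unfold alpha. assert (H : sqrt 35 * sqrt 35 = 35) by (apply sqrt_sqrt; lra). nra. }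
  pose proof alpha_bounds. unfold beta.
  apply Rmult_eq_reg_r with (10 + / (1 + alpha)).
  - rewrite Rinv_l.
    + field_simplify_eq; [lra | lra].
    + assert (0 < / (1 + alpha)) by (apply Rinv_0_lt_compat; lra). lra.
  - assert (0 < / (1 + alpha)) by (apply Rinv_0_lt_compat; lra). lra.
Qed.

Lemma beta_bounds : 91 / 100 < beta < 92 / 100.
Proof.
  pose proof alpha_bounds. unfold beta.
  split; apply Rmult_lt_reg_r with (1 + alpha); try lra; rewrite Rinv_l; lra.
Qed.

(* The piece (w, e) is the convex hull of the fractions whose digits start with [rev w] and continue
   with a digit in [e, 10]; [gap] separates the next digit e from the digits above e. *)
Definition span (w : list Z) (e : Z) : R :=
  Rabs (psi w (10 + beta) - psi w (IZR e + alpha)).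
Definition gap (w : list Z) (e : Z) : R :=
  Rabs (psi w (IZR e + 1 + alpha) - psi w (IZR e + beta)).

Lemma gap_eq w e : all_pos w -> (1 <= e)%Z ->
  gap w e = (1 - beta + alpha) /
    ((den w * (IZR e + 1 + alpha) + den' w) * (den w * (IZR e + beta) + den' w)).
Proof.
  intros Hw He. apply IZR_le in He. pose proof alpha_bounds. pose proof beta_bounds.
  unfold gap. rewrite psi_dist by (auto; lra). f_equal.
  rewrite Rabs_left; lra.
Qed.

(** With [psi_cons_left], this locates the piece (e :: w, 1) inside (w, e): it is the part whose
    next digit is exactly e. *)
Lemma psi_cons_right e w : all_pos w -> (1 <= e)%Z ->
  psi (e :: w) (10 + beta) = psi w (IZR e + alpha).
Proof.
  intros Hw He. pose proof alpha_bounds. pose proof beta_bounds.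
  rewrite psi_cons by (auto; lra). now rewrite <- alpha_eq.
Qed.

Lemma psi_cons_left e w : all_pos w -> (1 <= e)%Z ->
  psi (e :: w) (1 + alpha) = psi w (IZR e + beta).
Proof.
  intros Hw He. pose proof alpha_bounds. now rewrite psi_cons by (auto; lra).
Qed.

Lemma div_le_div a b c d : 0 <= a <= c -> 0 < d <= b -> a / b <= c / d.
Proof.
  intros. unfold Rdiv. apply Rmult_le_compat; try tauto.
  - apply Rlt_le, Rinv_0_lt_compat. lra.
  - apply Rinv_le_contravar; lra.
Qed.

(** Both lengths are quotients sharing the denominator factor at [e + beta]; the gap has the smaller
    numerator and the larger other factor. With [gap_le_span_succ], this says that the Cantor set of
    fractions has thickness at least 1. *)
Lemma gap_le_span_cons w e : all_pos w -> (1 <= e)%Z -> gap w e <= span (e :: w) 1.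
Proof.
  intros Hw He. unfold span. rewrite gap_eq, psi_cons_right, psi_cons_left by auto.
  apply IZR_le in He. pose proof alpha_bounds. pose proof beta_bounds.
  pose proof (den_bounds w Hw).
  rewrite psi_dist by (auto; lra). rewrite Rabs_pos_eq by lra.
  apply div_le_div; [lra|]. split.
  - apply Rmult_lt_0_compat; nra.
  - apply Rmult_le_compat_r; nra.
Qed.

(** As [e <= 9], at least one digit remains beyond the gap, and one digit is already wide enough. *)
Lemma gap_le_span_succ w e : all_pos w -> (1 <= e <= 9)%Z -> gap w e <= span w (e + 1).
Proof.
  intros Hw [He He']. unfold span. rewrite gap_eq, plus_IZR by auto.
  apply IZR_le in He, He'. pose proof alpha_bounds. pose proof beta_bounds.
  pose proof (den_bounds w Hw).
  rewrite psi_dist by (auto; lra). rewrite Rabs_left by lra.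
  set (x := IZR e) in *. set (q := den w) in *. set (r := den' w) in *.
  set (A := q * (x + 1 + alpha) + r). set (B := q * (x + beta) + r).
  set (D := q * (10 + beta) + r).
  assert (0 < A) by (unfold A; nra). assert (0 < B) by (unfold B; nra).
  assert (0 < D) by (unfold D; nra).
  apply Rmult_le_reg_r with (A * B * D); [repeat apply Rmult_lt_0_compat; auto|].
  replace ((1 - beta + alpha) / (A * B) * (A * B * D)) with ((1 - beta + alpha) * D)
    by (field; lra).
  replace (- (x + 1 + alpha - (10 + beta)) / (D * A) * (A * B * D))
    with ((9 - x + (beta - alpha)) * B) by (field; lra).
  (* The numerical bounds give 1 - beta + alpha <= 1/5 and beta - alpha >= 8/10. *)
  apply Rle_trans with (1 / 5 * D); [apply Rmult_le_compat_r; lra|].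
  apply Rle_trans with ((9 - x + 8 / 10) * B); [|apply Rmult_le_compat_r; lra].
  unfold B, D.
  assert (0 <= (9 - x) * (x - 1) * q) by (repeat apply Rmult_le_pos; lra).
  assert (0 <= (9 - x) * r) by (apply Rmult_le_pos; lra).
  assert (0 <= q * beta) by nra.
  assert (0 <= (9 - x) * (q * beta)) by (apply Rmult_le_pos; lra).
  assert (q * x <= q * 9) by nra.
  assert (q * beta <= q) by nra.
  assert (0 <= (9 - x) * q) by (apply Rmult_le_pos; lra).
  nra.
Qed.

(** With [gap_succ], gaps never grow under splitting, so a comparison with the other piece
    survives. *)
Lemma gap_cons w e : all_pos w -> (1 <= e)%Z -> gap (e :: w) 1 <= gap w e.
Proof.
  intros Hw He. assert (Hw' : all_pos (e :: w)) by (constructor; auto).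
  rewrite !gap_eq by (auto; lia). rewrite den_cons, den'_cons.
  apply IZR_le in He. pose proof alpha_bounds. pose proof beta_bounds.
  pose proof (den_bounds w Hw).
  apply div_le_div; [lra|]. split.
  - apply Rmult_lt_0_compat; nra.
  - assert (den w <= IZR e * den w) by nra.
    assert (den w * alpha <= (IZR e * den w + den' w) * alpha) by (apply Rmult_le_compat_r; lra).
    assert (0 <= (IZR e * den w + den' w) * beta) by (apply Rmult_le_pos; lra).
    apply Rmult_le_compat; nra.
Qed.

Lemma gap_succ w e : all_pos w -> (1 <= e)%Z -> gap w (e + 1) <= gap w e.
Proof.
  intros Hw He. rewrite !gap_eq by (auto; lia). rewrite plus_IZR.
  apply IZR_le in He. pose proof alpha_bounds. pose proof beta_bounds.
  pose proof (den_bounds w Hw).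
  apply div_le_div; [lra|]. split.
  - apply Rmult_lt_0_compat; nra.
  - apply Rmult_le_compat; nra.
Qed.

Lemma gap_le_den w e : all_pos w -> (1 <= e)%Z -> gap w e <= / (den w * den w).
Proof.
  intros Hw He. rewrite gap_eq by auto.
  apply IZR_le in He. pose proof alpha_bounds. pose proof beta_bounds.
  pose proof (den_bounds w Hw). rewrite <- Rdiv_1_l.
  apply div_le_div; [lra|]. split.
  - apply Rmult_lt_0_compat; nra.
  - apply Rmult_le_compat; nra.
Qed.

(** Turns a small gap, the stopping criterion of the splitting, into a good precision of the
    convergent. *)
Lemma den_le_gap w e : all_pos w -> (1 <= e <= 10)%Z -> / (den w * den w) <= 1000 * gap w e.
Proof.
  intros Hw [He He']. rewrite gap_eq by auto.
  apply IZR_le in He, He'. pose proof alpha_bounds. pose proof beta_bounds.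
  pose proof (den_bounds w Hw).
  (* The numerator of the gap exceeds 17/100, and its denominator is at most 13.1 * 12 < 170 times
     the square of [den w]. *)
  replace (/ (den w * den w)) with (1000 * ((17/100) / (170 * (den w * den w)))) by (field; lra).
  apply Rmult_le_compat_l; [lra|].
  apply div_le_div; [lra|]. split.
  - apply Rmult_lt_0_compat; nra.
  - apply Rle_trans with ((13.1 * den w) * (12 * den w)); [|nra].
    apply Rmult_le_compat; nra.
Qed.

(** * Hall's splitting argument *)

(** The end points of a piece come in either order, according to the sign of the determinant of its
    word. *)
Definition btw (a b v : R) : Prop := a <= v <= b \/ b <= v <= a.

(** The reflected interval from u - f1 to u - f2 contains v and is at least as long as the gap from
    g1 to g2. If v lies in the gap, this interval therefore reaches g1 or g2, which can replace
    v. *)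
Lemma btw_split e1 g1 g2 e2 f1 f2 u v :
  e1 <= g1 <= g2 /\ g2 <= e2 \/ e2 <= g2 <= g1 /\ g1 <= e1 ->
  Rabs (g1 - g2) <= Rabs (f1 - f2) ->
  btw e1 e2 v -> btw f1 f2 (u - v) ->
  (exists v', btw e1 g1 v' /\ btw f1 f2 (u - v')) \/
  (exists v', btw g2 e2 v' /\ btw f1 f2 (u - v')).
Proof.
  unfold btw. intros Ho Hg Hv Hf.
  assert (Hc : (btw e1 g1 v \/ btw g2 e2 v) \/
    (btw f1 f2 (u - g1) \/ btw f1 f2 (u - g2))).
  { unfold btw. revert Hg. unfold Rabs.
    destruct (Rcase_abs (g1 - g2)), (Rcase_abs (f1 - f2)); intros; lra. }
  destruct Hc as [[H|H]|[H|H]].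
  - left; exists v; auto.
  - right; exists v; auto.
  - left; exists g1; split; auto. lra.
  - right; exists g2; split; auto. lra.
Qed.

Definition digits (w : list Z) : Prop := Forall (fun d => 1 <= d <= 10)%Z w.

Definition valid (w : list Z) (e : Z) : Prop :=
  digits w /\ (1 <= e <= 10)%Z.

Definition in_piece (w : list Z) (e : Z) (v : R) : Prop :=
  btw (psi w (10 + beta)) (psi w (IZR e + alpha)) v.

(* Strictly increasing under splitting, since e <= 10 is reset to 1 when the word grows. *)
Definition progress (w : list Z) (e : Z) : Z := (11 * Z.of_nat (length w) + e)%Z.

Lemma digits_all_pos w : digits w -> all_pos w.
Proof. apply Forall_impl. lia. Qed.

Lemma psi_mono w : all_pos w ->
  (forall t t', 0 < t <= t' -> psi w t <= psi w t') \/
  (forall t t', 0 < t <= t' -> psi w t' <= psi w t).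
Proof.
  intros Hw. pose proof (den_bounds w Hw).
  assert (Hp : forall t t', 0 < t <= t' ->
    0 <= (t' - t) / ((den w * t + den' w) * (den w * t' + den' w))).
  { intros t t' Ht. apply Rmult_le_pos; [lra|].
    apply Rlt_le, Rinv_0_lt_compat, Rmult_lt_0_compat; nra. }
  assert (Hd := det_unit w). revert Hd. unfold Rabs. destruct (Rcase_abs _); intros Hd.
  - left. intros t t' Ht. specialize (Hp t t' Ht).
    apply Rminus_le. rewrite psi_sub by (auto; lra).
    replace (num' w * den w - num w * den' w) with (-1) by lra. unfold Rdiv in *. nra.
  - right. intros t t' Ht. specialize (Hp t t' Ht).
    apply Rminus_le. apply Ropp_le_cancel. rewrite Ropp_0, Ropp_minus_distr.
    rewrite psi_sub by (auto; lra). rewrite Hd. unfold Rdiv in *. nra.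
Qed.

(** Removing the gap leaves the fractions with next digit above e on one side and those with next
    digit e on the other; [btw_split] moves the point into one of the two. *)
Lemma piece_split w e f1 f2 u v :
  valid w e -> gap w e <= Rabs (f1 - f2) -> in_piece w e v -> btw f1 f2 (u - v) ->
  exists w' e' v', valid w' e' /\ in_piece w' e' v' /\ btw f1 f2 (u - v') /\
    gap w e <= span w' e' /\ gap w' e' <= gap w e /\ (progress w e < progress w' e')%Z.
Proof.
  intros [Hd He] Hg Hv Hf. assert (Hw := digits_all_pos w Hd).
  assert (Hv1 : valid (e :: w) 1) by (split; [constructor; auto | lia]).
  assert (Hpr : (progress w e < progress (e :: w) 1)%Z).
  { unfold progress. change (length (e :: w)) with (S (length w)). lia. }
  assert (Hc : (exists v', btw (psi w (10 + beta)) (psi w (IZR e + 1 + alpha)) v' /\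
        btw f1 f2 (u - v') /\ (e <= 9)%Z) \/
    (exists v', btw (psi w (IZR e + beta)) (psi w (IZR e + alpha)) v' /\ btw f1 f2 (u - v'))).
  (* For e = 10 nothing is cut out: the pieces (w, 10) and (10 :: w, 1) have the same end points. *)
  { destruct (Z.eq_dec e 10) as [->|Hne].
    - right. exists v. split; auto.
    - assert (Hc := He). destruct Hc as [Hc1 _]. assert (Hc2 : (e <= 9)%Z) by lia.
      apply IZR_le in Hc1. assert (Hc3 := IZR_le _ _ Hc2).
      pose proof alpha_bounds. pose proof beta_bounds.
      destruct (btw_split (psi w (10 + beta)) (psi w (IZR e + 1 + alpha))
        (psi w (IZR e + beta)) (psi w (IZR e + alpha)) f1 f2 u v) as [[v' Hv']|[v' Hv']]; auto.
      + destruct (psi_mono w Hw) as [Hm|Hm]; [right|left]; repeat split; apply Hm; lra.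
      + left. exists v'. tauto.
      + right. exists v'. tauto. }
  destruct Hc as [(v' & H1 & H2 & H3)|(v' & H1 & H2)].
  - exists w, (e + 1)%Z, v'. repeat split; auto; try lia.
    + unfold in_piece. now rewrite plus_IZR.
    + apply gap_le_span_succ; auto; lia.
    + apply gap_succ; auto; lia.
    + unfold progress; lia.
  - exists (e :: w), 1%Z, v'. split; [auto|]. split; [|split; [auto|split; [|split; auto]]].
    + unfold in_piece. rewrite psi_cons_right, psi_cons_left by (auto; lia).
      unfold btw in *; lra.
    + apply gap_le_span_cons; auto; lia.
    + apply gap_cons; auto; lia.
Qed.

Lemma piece_fine eps : 0 < eps -> exists B : Z, forall w e, valid w e ->
  (B <= progress w e)%Z -> gap w e < eps.
Proof.
  intros Heps. destruct (INR_archimed eps 1) as [n Hn]; auto.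
  (* Since [e <= 10], this much progress forces at least n + 1 digits, hence [den w >= n + 1], while
     n eps > 1. *)
  exists (11 * Z.of_nat (S n) + 11)%Z. intros w e [Hd He] HB.
  assert (Hw := digits_all_pos w Hd).
  assert (Hl : (S n <= length w)%nat) by (unfold progress in HB; lia).
  apply le_INR in Hl. pose proof (den_ge_length w Hw) as [Hq _].
  rewrite S_INR in Hl. pose proof (pos_INR n).
  apply Rle_lt_trans with (1 := gap_le_den w e Hw (proj1 He)).
  apply Rmult_lt_reg_r with (den w * den w); [nra|]. rewrite Rinv_l by nra.
  assert (INR n * eps <= den w * den w * eps) by (apply Rmult_le_compat_r; nra). lra.
Qed.

(* Splitting the piece with the larger gap preserves "each gap is at most the span of the other
   piece", because a gap is at most the span of each of the two pieces it separates. *)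
Lemma hall_loop eps B :
  (forall w e, valid w e -> (B <= progress w e)%Z -> gap w e < eps) ->
  forall (n : nat) w1 e1 w2 e2 u v,
  (Z.to_nat (B - progress w1 e1) + Z.to_nat (B - progress w2 e2) <= n)%nat ->
  valid w1 e1 -> valid w2 e2 -> in_piece w1 e1 v -> in_piece w2 e2 (u - v) ->
  gap w1 e1 <= span w2 e2 -> gap w2 e2 <= span w1 e1 ->
  exists w1' e1' w2' e2' v', valid w1' e1' /\ valid w2' e2' /\
    in_piece w1' e1' v' /\ in_piece w2' e2' (u - v') /\
    gap w1' e1' < eps /\ gap w2' e2' < eps.
Proof.
  intros HB. induction n as [|n IH]; intros w1 e1 w2 e2 u v Hn Hv1 Hv2 H1 H2 Hg1 Hg2.
  - exists w1, e1, w2, e2, v. do 4 (split; [auto|]). split; apply HB; auto; lia.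
  - destruct (Rlt_dec (Rmax (gap w1 e1) (gap w2 e2)) eps) as [Hs|Hs].
    { apply Rmax_Rlt in Hs. exists w1, e1, w2, e2, v. tauto. }
    destruct (Rle_dec (gap w2 e2) (gap w1 e1)) as [Hc|Hc].
    + rewrite Rmax_left in Hs by lra.
      assert (Hp : (progress w1 e1 < B)%Z)
        by (apply Z.nle_gt; intros Hp; apply Hs, HB; auto).
      destruct (piece_split w1 e1 (psi w2 (10 + beta)) (psi w2 (IZR e2 + alpha)) u v)
        as (w' & e' & v' & Hv' & Hi & Hb & Hsp & Hgp & Hpr); auto.
      apply (IH w' e' w2 e2 u v'); auto; [lia | lra | lra].
    + rewrite Rmax_right in Hs by lra.
      assert (Hp : (progress w2 e2 < B)%Z)
        by (apply Z.nle_gt; intros Hp; apply Hs, HB; auto).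
      destruct (piece_split w2 e2 (psi w1 (10 + beta)) (psi w1 (IZR e1 + alpha)) u (u - v))
        as (w' & e' & v' & Hv' & Hi & Hb & Hsp & Hgp & Hpr); auto.
      { replace (u - (u - v)) with v by ring. exact H1. }
      apply (IH w1 e1 w' e' u (u - v')); auto; [lia | | lra | lra].
      replace (u - (u - v')) with v' by ring. exact Hi.
Qed.

Lemma ev_near w e v x : valid w e -> in_piece w e v -> 0 <= x <= 1 ->
  Rabs (ev (rev w) x - v) <= / (den w * den w).
Proof.
  intros [Hd He] Hv Hx. assert (Hw := digits_all_pos w Hd).
  destruct He as [He He']. apply IZR_le in He, He'.
  pose proof alpha_bounds. pose proof beta_bounds. pose proof (den_bounds w Hw).
  assert (Hb : forall t, 1 <= t -> Rabs (ev (rev w) x - psi w t) <= / (den w * den w)).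
  { intros t Ht. rewrite ev_rev by (auto; lra). unfold psi.
    (* The left fraction is [psi w] at 1/x, written so as to allow x = 0; hence the factor x t - 1
       in place of a difference of arguments. *)
    replace ((num w + num' w * x) / (den w + den' w * x) -
        (num w * t + num' w) / (den w * t + den' w))
      with ((num' w * den w - num w * den' w) * ((x * t - 1) /
        ((den w + den' w * x) * (den w * t + den' w)))) by (field; split; nra).
    rewrite Rabs_mult, det_unit, Rmult_1_l. unfold Rdiv.
    assert (0 < (den w + den' w * x) * (den w * t + den' w))
      by (apply Rmult_lt_0_compat; nra).
    rewrite Rabs_mult, Rabs_inv, (Rabs_pos_eq (_ * _)) by lra.
    replace (/ (den w * den w)) with (t / (den w * (den w * t))) by (field; lra).
    apply div_le_div.
    - split; [apply Rabs_pos|]. apply Rabs_le. nra.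
    - split; [apply Rmult_lt_0_compat; nra|]. apply Rmult_le_compat; nra. }
  assert (E1 := Hb (10 + beta) ltac:(lra)). assert (E2 := Hb (IZR e + alpha) ltac:(lra)).
  apply Rabs_le_between in E1, E2. apply Rabs_le.
  unfold in_piece, btw in Hv. lra.
Qed.

(** Uniformity in x and y is essential: what surrounds the two words is fixed only when the blocks
    are spliced. *)
Lemma hall_sum u eps : 2 * alpha <= u <= 2 * beta -> 0 < eps ->
  exists X Y, digits X /\ digits Y /\ forall x y, 0 <= x <= 1 -> 0 <= y <= 1 -> Rabs (ev X x + ev Y y - u) <= eps.
Proof.
  intros Hu Heps. pose proof alpha_bounds. pose proof beta_bounds.
  (* By [den_le_gap], gaps below eps / 2000 leave an error of at most eps / 2 in each fraction. *)
  assert (Heps' : 0 < eps / 2000) by lra.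
  destruct (piece_fine (eps / 2000) Heps') as [B HB].
  assert (Hv : valid [] 1) by (split; [constructor | lia]).
  (* Both searches start from the root piece [alpha, beta], with u split evenly. *)
  assert (Hp : in_piece [] 1 (u / 2)).
  { unfold in_piece. replace (psi [] (10 + beta)) with alpha.
    - replace (psi [] (1 + alpha)) with beta; [left; lra|].
      unfold psi, beta, num, num', den, den'; simpl. field. lra.
    - rewrite alpha_eq at 1. unfold psi, num, num', den, den'; simpl. field. lra. }
  assert (Hg : gap [] 1 <= span [] 1).
  { unfold gap, span. unfold psi, num, num', den, den'; simpl.
    replace ((0 * (10 + beta) + 1) / (1 * (10 + beta) + 0)) with alpha
      by (rewrite alpha_eq at 1; field; lra).
    replace ((0 * (1 + alpha) + 1) / (1 * (1 + alpha) + 0)) with beta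
      by (unfold beta; field; lra).
    rewrite (Rabs_left (alpha - beta)) by lra.
    apply Rle_trans with (/ 2); [|lra].
    replace ((0 * (1 + 1 + alpha) + 1) / (1 * (1 + 1 + alpha) + 0) -
       (0 * (1 + beta) + 1) / (1 * (1 + beta) + 0))
      with ((beta - 1 - alpha) * / ((2 + alpha) * (1 + beta))) by (field; lra).
    rewrite Rabs_left.
    - apply Rmult_le_reg_r with ((2 + alpha) * (1 + beta)); [nra|]. field_simplify; [|lra]. nra.
    - assert (0 < / ((2 + alpha) * (1 + beta))) by (apply Rinv_0_lt_compat; nra). nra. }
  destruct (hall_loop _ _ HB _ [] 1 [] 1 u (u / 2) (le_n _))
    as (w1 & e1 & w2 & e2 & v & V1 & V2 & P1 & P2 & G1 & G2); auto.
  { replace (u - u / 2) with (u / 2) by lra; auto. }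
  exists (rev w1), (rev w2). split; [|split].
  1, 2: apply Forall_rev; apply V1 || apply V2.
  intros x y Hx Hy.
  pose proof (ev_near _ _ _ _ V1 P1 Hx) as E1. pose proof (ev_near _ _ _ _ V2 P2 Hy) as E2.
  destruct V1 as [D1 L1], V2 as [D2 L2].
  pose proof (den_le_gap _ _ (digits_all_pos _ D1) L1).
  pose proof (den_le_gap _ _ (digits_all_pos _ D2) L2).
  apply Rabs_le_between in E1, E2. apply Rabs_le. lra.
Qed.

(** * Best approximation by convergents *)

Fixpoint hist (a : nat -> Z) (n : nat) : list Z :=
  match n with
  | O => []
  | S m => a m :: hist a m
  end.

Fixpoint fwd (a : nat -> Z) (n k : nat) : list Z :=
  match k with
  | O => []
  | S j => a n :: fwd a (S n) j
  end.

Definition tail (a : nat -> Z) (n : nat) : R :=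
  real (Lim_seq (fun k => ev (fwd a n k) 0)).

Lemma hist_pos a n : (forall i, 1 <= a i)%Z -> all_pos (hist a n).
Proof. intros Ha. induction n; simpl; constructor; auto. Qed.

Lemma fwd_pos a n k : (forall i, 1 <= a i)%Z -> all_pos (fwd a n k).
Proof. intros Ha. revert n. induction k; simpl; constructor; auto. apply IHk. Qed.

Lemma fwd_app a n k j : fwd a n (k + j) = fwd a n k ++ fwd a (n + k) j.
Proof.
  revert n. induction k as [|k IH]; intros n; simpl.
  - now rewrite Nat.add_0_r.
  - now rewrite IH, Nat.add_succ_r.
Qed.

Lemma rev_hist a n : rev (hist a n) = fwd a 0 n.
Proof.
  induction n as [|n IH]; auto. simpl rev. rewrite IH.
  replace (S n) with (n + 1)%nat by lia. now rewrite fwd_app.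
Qed.

Lemma hist_length a n : length (hist a n) = n.
Proof. induction n; simpl; auto. Qed.

Lemma fwd_length a n k : length (fwd a n k) = k.
Proof. revert n. induction k; simpl; auto. Qed.

(** The difference is |x - y| over a product of two denominators; one is at least the length of the
    word, the other at least 1. *)
Lemma ev_dist w x y : all_pos w -> 0 <= x <= 1 -> 0 <= y <= 1 ->
  INR (length w) * Rabs (ev w x - ev w y) <= 1.
Proof.
  intros Hw Hx Hy. assert (Hr : all_pos (rev w)) by (apply Forall_rev; auto).
  pose proof (den_bounds _ Hr). destruct (den_ge_length _ Hr) as [Hl _].
  rewrite length_rev in Hl. rewrite <- (rev_involutive w) at 2 3.
  rewrite !ev_rev by (auto; lra). revert H Hl.
  assert (Hd := det_unit (rev w)). revert Hd.
  generalize (num (rev w)) (num' (rev w)) (den (rev w)) (den' (rev w)). intros p p' q q' Hd H Hl.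
  assert (0 <= q' * x) by nra. assert (0 <= q' * y) by nra.
  replace ((p + p' * x) / (q + q' * x) - (p + p' * y) / (q + q' * y))
    with ((p' * q - p * q') * ((x - y) / ((q + q' * x) * (q + q' * y)))) by (field; lra).
  rewrite Rabs_mult, Hd, Rmult_1_l. unfold Rdiv.
  rewrite Rabs_mult, Rabs_inv, (Rabs_pos_eq (_ * _)) by (apply Rmult_le_pos; lra).
  assert (Rabs (x - y) <= 1) by (apply Rabs_le; lra).
  assert (Hpos : 0 < (q + q' * x) * (q + q' * y)) by (apply Rmult_lt_0_compat; lra).
  apply Rmult_le_reg_r with (1 := Hpos).
  replace (INR (length w) * (Rabs (x - y) * / ((q + q' * x) * (q + q' * y))) *
    ((q + q' * x) * (q + q' * y))) with (INR (length w) * Rabs (x - y)) by (field; lra).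
  pose proof (Rabs_pos (x - y)). pose proof (pos_INR (length w)).
  apply Rle_trans with (q * 1); [apply Rmult_le_compat; lra|].
  rewrite Rmult_1_l. apply Rmult_le_compat; lra.
Qed.

Lemma tail_is_lim a n : (forall i, 1 <= a i)%Z ->
  is_lim_seq (fun k => ev (fwd a n k) 0) (tail a n).
Proof.
  intros Ha. apply Lim_seq_correct', ex_lim_seq_cauchy_corr.
  intros eps. destruct (INR_archimed (eps / 2) 1) as [N HN]; [destruct eps; simpl; lra|].
  exists (S N).
  assert (Hc : forall k, (S N <= k)%nat ->
    Rabs (ev (fwd a n k) 0 - ev (fwd a n (S N)) 0) < eps / 2).
  { intros k Hk. replace k with (S N + (k - S N))%nat by lia.
    rewrite fwd_app, ev_app.
    assert (H := ev_dist (fwd a n (S N)) (ev (fwd a (n + S N) (k - S N)) 0) 0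
      (fwd_pos _ _ _ Ha) (ev_le1 _ 0 (fwd_pos _ _ _ Ha) ltac:(lra)) ltac:(lra)).
    rewrite fwd_length, S_INR in H.
    pose proof (pos_INR N). destruct eps as [eps Heps]; simpl in *.
    apply Rmult_lt_reg_l with (INR N + 1); [lra|]. lra. }
  intros k m Hk Hm. specialize (Hc k Hk) as H1. specialize (Hc m Hm) as H2.
  apply Rabs_lt_between in H1, H2. apply Rabs_lt_between. lra.
Qed.

Lemma tail_bounds a n : (forall i, 1 <= a i)%Z -> 0 <= tail a n <= 1.
Proof.
  intros Ha. assert (H := tail_is_lim a n Ha).
  assert (Hb : forall k, 0 <= ev (fwd a n k) 0 <= 1)
    by (intros k; apply ev_le1; [apply fwd_pos; auto | lra]).
  split.
  - apply (is_lim_seq_le (fun _ => 0) _ (Finite 0) (Finite (tail a n))) in H;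
      [exact H | intros k; apply Hb | apply is_lim_seq_const].
  - apply (is_lim_seq_le _ (fun _ => 1) (Finite (tail a n)) (Finite 1)) in H;
      [exact H | intros k; apply Hb | apply is_lim_seq_const].
Qed.

Lemma tail_ev a n k : (forall i, 1 <= a i)%Z ->
  tail a n = ev (fwd a n k) (tail a (n + k)).
Proof.
  intros Ha. revert n. induction k as [|k IH]; intros n; simpl.
  - now rewrite Nat.add_0_r.
  - replace (n + S k)%nat with (S n + k)%nat by lia. rewrite <- IH.
    pose proof (tail_bounds a (S n) Ha). pose proof (IZR_le _ _ (Ha n)).
    assert (H1 := tail_is_lim a n Ha). apply is_lim_seq_incr_1 in H1. simpl in H1.
    assert (H2 : is_lim_seq (fun k => / (IZR (a n) + ev (fwd a (S n) k) 0))
      (/ (IZR (a n) + tail a (S n)))).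
    { apply (is_lim_seq_inv _ (Finite (IZR (a n) + tail a (S n)))).
      - apply is_lim_seq_plus'; [apply is_lim_seq_const | now apply tail_is_lim].
      - intros E. injection E. lra. }
    apply is_lim_seq_unique in H1, H2. rewrite H1 in H2. injection H2. auto.
Qed.

Lemma tail_succ a n : (forall i, 1 <= a i)%Z -> tail a n * (IZR (a n) + tail a (S n)) = 1.
Proof.
  intros Ha. rewrite (tail_ev a n 1 Ha). simpl. rewrite Nat.add_1_r.
  pose proof (tail_bounds a (S n) Ha). pose proof (IZR_le _ _ (Ha n)). field. lra.
Qed.

Lemma tail_pos a n : (forall i, 1 <= a i)%Z -> 0 < tail a n.
Proof.
  intros Ha. pose proof (tail_succ a n Ha). destruct (tail_bounds a n Ha) as [[H0|H0] _]; auto.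
  rewrite <- H0 in H. lra.
Qed.

Lemma tail_lt1 a n : (forall i, 1 <= a i)%Z -> tail a n < 1.
Proof.
  intros Ha. pose proof (tail_succ a n Ha). pose proof (tail_pos a (S n) Ha).
  pose proof (IZR_le _ _ (Ha n)). pose proof (tail_pos a n Ha). nra.
Qed.

Definition err (a : nat -> Z) (n : nat) : R := den (hist a n) * tail a 0 - num (hist a n).
(** Hall's two-sided sum at position n. By [den_err] it is 1 / (q |q s - p|) for s = [tail a 0] and
    its convergent p/q with n digits. *)
Definition quality (a : nat -> Z) (n : nat) : R :=
  IZR (a n) + tail a (S n) + ev (hist a n) 0.

Lemma err_eq a n : (forall i, 1 <= a i)%Z ->
  err a n = (num' (hist a n) * den (hist a n) - num (hist a n) * den' (hist a n)) * tail a n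
    / (den (hist a n) + den' (hist a n) * tail a n).
Proof.
  intros Ha. unfold err. rewrite (tail_ev a 0 n Ha), <- rev_hist. simpl Nat.add.
  pose proof (hist_pos a n Ha) as Hp. pose proof (tail_pos a n Ha).
  pose proof (den_bounds _ Hp). rewrite ev_rev by (auto; lra). field. nra.
Qed.

Lemma err_succ a n : (forall i, 1 <= a i)%Z -> err a (S n) = - tail a (S n) * err a n.
Proof.
  intros Ha. rewrite !err_eq by auto. simpl hist. rewrite det_step, den_cons, den'_cons.
  pose proof (hist_pos a n Ha) as Hp. pose proof (tail_pos a n Ha). pose proof (tail_pos a (S n) Ha).
  pose proof (den_bounds _ Hp). pose proof (IZR_le _ _ (Ha n)).
  assert (E : tail a n = / (IZR (a n) + tail a (S n)))
    by (apply Rmult_eq_reg_r with (IZR (a n) + tail a (S n)); [rewrite tail_succ, Rinv_l; auto|]; lra).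
  rewrite E. field. repeat split; nra.
Qed.

Lemma quality_pos a n : (forall i, 1 <= a i)%Z -> 1 <= quality a n.
Proof.
  intros Ha. unfold quality. pose proof (tail_pos a (S n) Ha). pose proof (IZR_le _ _ (Ha n)).
  pose proof (ev_nonneg (hist a n) 0 (hist_pos a n Ha) (Rle_refl 0)). lra.
Qed.

Lemma den_err a n : (forall i, 1 <= a i)%Z -> den (hist a n) * Rabs (err a n) = / quality a n.
Proof.
  intros Ha. pose proof (quality_pos a n Ha) as Hq. revert Hq. unfold quality.
  pose proof (hist_pos a n Ha) as Hp. rewrite err_eq, ev_nil_den by auto.
  pose proof (tail_pos a n Ha). pose proof (tail_pos a (S n) Ha).
  pose proof (den_bounds _ Hp). pose proof (IZR_le _ _ (Ha n)). intros Hq.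
  unfold Rdiv at 1. rewrite !Rabs_mult, det_unit, Rabs_inv.
  rewrite (Rabs_pos_eq (tail a n)), (Rabs_pos_eq (_ + _)) by nra.
  assert (E : tail a n = / (IZR (a n) + tail a (S n)))
    by (apply Rmult_eq_reg_r with (IZR (a n) + tail a (S n)); [rewrite tail_succ, Rinv_l; auto|]; lra).
  rewrite E. field. repeat split; nra.
Qed.

Lemma err_abs_gt0 a n : (forall i, 1 <= a i)%Z -> 0 < Rabs (err a n).
Proof.
  intros Ha. pose proof (den_err a n Ha). pose proof (quality_pos a n Ha).
  assert (0 < / quality a n) by (apply Rinv_0_lt_compat; lra).
  pose proof (den_bounds _ (hist_pos a n Ha)). pose proof (Rabs_pos (err a n)). nra.
Qed.

Lemma lattice_coords w (b p : Z) : exists u v : Z,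
  IZR b = IZR u * den w + IZR v * den' w /\ IZR p = IZR u * num w + IZR v * num' w.
Proof.
  assert (Hd := det_unit w). revert Hd.
  unfold num, num', den, den'.
  generalize (fst (cont (0, 1)%Z w)) (snd (cont (0, 1)%Z w))
    (fst (cont (1, 0)%Z w)) (snd (cont (1, 0)%Z w)). intros x x' y y'.
  rewrite <- !mult_IZR, <- minus_IZR, <- abs_IZR. intros Hd. apply eq_IZR in Hd.
  set (d := (x' * y - x * y')%Z) in *.
  assert (Hdd : (d * d = 1)%Z) by nia.
  (* Cramer's rule: as d is 1 or -1, multiplying by d divides by the determinant. *)
  exists (d * (x' * b - y' * p))%Z, (d * (y * p - x * b))%Z.
  rewrite <- !mult_IZR, <- !plus_IZR.
  split; f_equal.
  - transitivity (d * d * b)%Z; [rewrite Hdd|]; unfold d; ring.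
  - transitivity (d * d * p)%Z; [rewrite Hdd|]; unfold d; ring.
Qed.

(** In the basis of two consecutive convergents, the bounds on b force v to be nonzero and u to be
    zero or of opposite sign. Consecutive errors alternate in sign, so the two contributions
    reinforce each other. *)
Lemma best_approximation a n (b p : Z) : (forall i, 1 <= a i)%Z ->
  0 < IZR b < den (hist a (S n)) ->
  Rabs (err a n) <= Rabs (IZR b * tail a 0 - IZR p).
Proof.
  intros Ha Hlt. destruct (lattice_coords (hist a (S n)) b p) as (u & v & Hb & Hp).
  simpl hist in Hb at 2. simpl hist in Hp at 2. rewrite den'_cons in Hb. rewrite num'_cons in Hp.
  replace (IZR b * tail a 0 - IZR p) with (IZR u * err a (S n) + IZR v * err a n)
    by (rewrite Hb, Hp; unfold err; ring).
  rewrite err_succ by auto.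
  replace (IZR u * (- tail a (S n) * err a n) + IZR v * err a n)
    with ((IZR v - IZR u * tail a (S n)) * err a n) by ring.
  rewrite Rabs_mult. rewrite <- (Rmult_1_l (Rabs (err a n))) at 1.
  apply Rmult_le_compat_r; [apply Rabs_pos|].
  pose proof (tail_pos a (S n) Ha). pose proof (tail_lt1 a (S n) Ha).
  destruct (den_bounds _ (hist_pos a n Ha)) as [H1 _].
  destruct (Z.lt_trichotomy u 0) as [Hu|[Hu|Hu]].
  - assert (Hv : (1 <= v)%Z).
    { apply Z.nlt_ge; intros Hv. assert (v <= 0)%Z as Hv' by lia.
      apply IZR_le in Hv'. apply IZR_lt in Hu. nra. }
    apply IZR_le in Hv. apply IZR_lt in Hu. rewrite Rabs_pos_eq; nra.
  - subst u. assert (Hv : (1 <= v)%Z).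
    { apply Z.nlt_ge; intros Hv. assert (v <= 0)%Z as Hv' by lia.
      apply IZR_le in Hv'. nra. }
    apply IZR_le in Hv. rewrite Rabs_pos_eq; nra.
  - assert (Hv : (v <= -1)%Z).
    { apply Z.nlt_ge; intros Hv. assert (0 <= v)%Z as Hv' by lia.
      assert (1 <= u)%Z as Hu' by lia.
      apply IZR_le in Hv', Hu'. nra. }
    apply IZR_le in Hv. apply IZR_lt in Hu. rewrite Rabs_left1; nra.
Qed.

Lemma den_hist_mono a n m : (forall i, 1 <= a i)%Z -> (n <= m)%nat ->
  den (hist a n) <= den (hist a m).
Proof.
  intros Ha. induction 1 as [|m _ IH]; [lra|]. simpl hist. rewrite den_cons.
  pose proof (IZR_le _ _ (Ha m)). pose proof (den_bounds _ (hist_pos a m Ha)). nra.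
Qed.

Lemma den_hist_bracket a x : (forall i, 1 <= a i)%Z -> 1 <= x ->
  exists n, den (hist a n) <= x < den (hist a (S n)).
Proof.
  intros Ha Hx. destruct (INR_archimed 1 x) as [N HN]; [lra|].
  assert (Hl := proj1 (den_ge_length _ (hist_pos a N Ha))). rewrite hist_length in Hl.
  assert (HN' : x < den (hist a N)) by lra. clear HN Hl.
  induction N as [|N IH].
  - unfold den in HN'. simpl in HN'. lra.
  - destruct (Rle_dec (den (hist a N)) x); [exists N; lra | apply IH; lra].
Qed.

(** * Reduction to the vertical chain *)

Definition chain_pt (s : R) : pt := ((0, s), (0, 0)).

Lemma dCyg_chain s r :
  dCyg (chain_pt s) r = sqrt (2 * Cmod (fst r - (0, s))%C + Cmod (snd r) ^ 2).
Proof.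
  destruct r as [[x1 x2] [y1 y2]]. unfold dCyg, cyg_gauge, cyg_mul, cyg_inv, chain_pt. simpl fst; simpl snd.
  assert (E : Cmod (0, 0) = 0) by exact Cmod_0. rewrite E. f_equal. f_equal; [f_equal; f_equal|f_equal; f_equal];
  apply injective_projections; simpl; ring.
Qed.

Lemma Cmod_imag y : Cmod (0, y) = Rabs y.
Proof. unfold Cmod; simpl. replace (0 * (0 * 1) + y * (y * 1)) with (Rsqr y) by (unfold Rsqr; ring). apply sqrt_Rsqr_abs. Qed.

Lemma gauss_int_Cmod_ge1 z : is_gauss_int z -> z <> RtoC 0 -> 1 <= Cmod z.
Proof.
  intros (a & b & ->) Hz. unfold Cmod; simpl fst; simpl snd.
  rewrite <- sqrt_1. apply sqrt_le_1_alt.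
  replace (IZR a ^ 2 + IZR b ^ 2) with (IZR (a * a + b * b)) by (rewrite plus_IZR, !mult_IZR; ring).
  apply IZR_le. destruct (Z.eq_dec a 0) as [->|Ha]; [|nia].
  destruct (Z.eq_dec b 0) as [->|Hb]; [|nia]. exfalso; apply Hz; reflexivity.
Qed.

(** For a/b in lowest terms with b > 0, this is h(r) d'(x, r) at x = (i s, 0) and r = (i a/b, 0). *)
Definition gcost (s : R) (a b : Z) : R := sqrt (2 * (IZR b * Rabs (IZR b * s - IZR a))).

Lemma gcost_le s y (a b : Z) h : IZR b * y = IZR a -> 0 <= IZR b <= h ->
  gcost s a b <= h * sqrt (2 * Rabs (y - s)).
Proof.
  intros E Hb. unfold gcost. rewrite <- E.
  replace (IZR b * s - IZR b * y) with (IZR b * - (y - s)) by ring.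
  rewrite Rabs_mult, Rabs_Ropp, (Rabs_pos_eq (IZR b)) by lra.
  replace (2 * (IZR b * (IZR b * Rabs (y - s)))) with ((IZR b)² * (2 * Rabs (y - s)))
    by (unfold Rsqr; ring).
  rewrite (sqrt_mult_alt (IZR b)²), sqrt_Rsqr by (try apply Rle_0_sqr; lra).
  apply Rmult_le_compat_r; [apply sqrt_pos | lra].
Qed.

Lemma height_ge1 r h : height r h -> 1 <= h.
Proof.
  intros (p & p' & q & _ & _ & Hq & Hq0 & _ & _ & _ & ->). now apply gauss_int_Cmod_ge1.
Qed.

(** On the chain the Gaussian denominator q must be traded for an integer one: the larger of its two
    coordinates. This costs at most a factor 2 in height, and [Rmax H 1] keeps the integer
    nonzero. *)
Lemma chain_lower s t0 H r h : t0 <= 1 ->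
  (forall a b : Z, H <= IZR b -> 0 < IZR b -> t0 <= gcost s a b) ->
  in_QQ r -> height r h -> 2 * Rmax H 1 <= h -> t0 <= h * dCyg (chain_pt s) r.
Proof.
  intros Ht HH [Hr _] (p & p' & q & Hp & Hp' & Hq & Hq0 & _ & E1 & E2 & ->) Hh.
  assert (Hm : 0 < Cmod q) by (apply Cmod_gt_0; auto).
  rewrite dCyg_chain. destruct (Ceq_dec p' (RtoC 0)) as [->|Hp0].
  - destruct r as [[y1 y] w]. simpl fst in *; simpl snd in *.
    assert (w = RtoC 0) as -> by (rewrite E2; unfold Cdiv; ring).
    unfold in_QR in Hr; simpl fst in Hr; simpl snd in Hr. rewrite Cmod_0 in *.
    assert (y1 = 0) as -> by (simpl in Hr; lra).
    replace ((0, y) - (0, s))%C with ((0, y - s) : C)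
      by (apply injective_projections; simpl; ring).
    rewrite Cmod_imag. replace (2 * Rabs (y - s) + 0 ^ 2) with (2 * Rabs (y - s)) by ring.
    destruct Hq as (b1 & b2 & ->). destruct Hp as (p1 & p2 & ->).
    assert (Ep : (IZR p1, IZR p2) = Cmult (0, y) (IZR b1, IZR b2)).
    { rewrite E1. unfold Cdiv. now rewrite <- Cmult_assoc, Cinv_l, Cmult_1_r. }
    injection Ep as Ep1 Ep2.
    (* From p = i y q, both b1 y = p2 and b2 y = - p1 hold, so either coordinate can serve as b. *)
    assert (Hc : forall b c : Z, IZR b * y = IZR c -> Rabs (IZR b) <= Cmod (IZR b1, IZR b2) ->
      Rmax H 1 <= Rabs (IZR b) -> t0 <= Cmod (IZR b1, IZR b2) * sqrt (2 * Rabs (y - s))).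
    { intros b c Ec Hb1 Hb2. pose proof (Rmax_l H 1). pose proof (Rmax_r H 1).
      destruct (Rle_dec 0 (IZR b)) as [Hs|Hs].
      - rewrite Rabs_pos_eq in * by lra.
        apply Rle_trans with (gcost s c b); [apply HH; lra|]. apply gcost_le; lra.
      - rewrite Rabs_left in * by lra.
        apply Rle_trans with (gcost s (- c) (- b)); [apply HH; rewrite opp_IZR; lra|].
        apply gcost_le; rewrite !opp_IZR; lra. }
    assert (Hmax := Rmax_Cmod (IZR b1, IZR b2)). assert (H2 := Cmod_2Rmax (IZR b1, IZR b2)).
    simpl fst in *; simpl snd in *.
    assert (Hs2 : sqrt 2 <= 2) by (rewrite <- (sqrt_Rsqr 2) at 2 by lra;
      apply sqrt_le_1_alt; unfold Rsqr; lra).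
    assert (Hge : Rmax H 1 <= Rmax (Rabs (IZR b1)) (Rabs (IZR b2))).
    { pose proof (Rabs_pos (IZR b1)). pose proof (Rmax_l (Rabs (IZR b1)) (Rabs (IZR b2))).
      assert (sqrt 2 * Rmax (Rabs (IZR b1)) (Rabs (IZR b2)) <= 2 * Rmax (Rabs (IZR b1)) (Rabs (IZR b2)))
        by (apply Rmult_le_compat_r; lra). 
      apply Rmult_le_reg_l with 2; [lra|].
      exact (Rle_trans _ _ _ Hh (Rle_trans _ _ _ H2 H3)). }
    destruct (Rle_dec (Rabs (IZR b1)) (Rabs (IZR b2))) as [Hle|Hle].
    + rewrite (Rmax_right (Rabs (IZR b1))) in Hmax, Hge by lra.
      apply (Hc b2 (- p1)%Z); [rewrite opp_IZR; lra | exact Hmax | exact Hge].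
    + rewrite (Rmax_left (Rabs (IZR b1))) in Hmax, Hge by lra. apply (Hc b1 p2); [lra | exact Hmax | exact Hge].
  - assert (Hp1 := gauss_int_Cmod_ge1 _ Hp' Hp0).
    apply Rle_trans with (Cmod q * sqrt (Rsqr (Cmod (snd r)))).
    + rewrite sqrt_Rsqr by apply Cmod_ge_0. rewrite E2, Cmod_div by auto.
      replace (Cmod q * (Cmod p' / Cmod q)) with (Cmod p') by (field; lra). lra.
    + apply Rmult_le_compat_l; [lra|]. apply sqrt_le_1_alt. unfold Rsqr.
      pose proof (Cmod_ge_0 (fst r - (0, s))%C). lra.
Qed.

Lemma chain_approximant s (a b u v : Z) : (0 < b)%Z -> (a * u + b * v = 1)%Z ->
  exists r, in_QQ r /\ height r (IZR b) /\ IZR b * dCyg (chain_pt s) r = gcost s a b.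
Proof.
  intros Hb Hbez. assert (Hb' := IZR_lt _ _ Hb).
  assert (Hq0 : (IZR b, 0) <> RtoC 0) by (intros E; injection E; lra).
  assert (E1 : ((0, IZR a / IZR b) : C) = Cdiv (0, IZR a) (IZR b, 0)).
  { unfold Cdiv, Cinv, Cmult. apply injective_projections; simpl; field; lra. }
  assert (E2 : RtoC 0 = Cdiv (RtoC 0) (IZR b, 0)) by (unfold Cdiv; ring).
  assert (G0 : is_gauss_int (RtoC 0)) by (exists 0%Z, 0%Z; reflexivity).
  assert (Ga : is_gauss_int (0, IZR a)) by (exists 0%Z, a; reflexivity).
  assert (Gb : is_gauss_int (IZR b, 0)) by (exists b, 0%Z; reflexivity).
  exists (((0, IZR a / IZR b) : C), RtoC 0). split; [|split].
  - split; [|split].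
    + unfold in_QR; simpl fst; simpl snd. rewrite Cmod_0. simpl. ring.
    + exists (0, IZR a), (IZR b, 0). auto.
    + exists (RtoC 0), (IZR b, 0). auto.
  - exists (0, IZR a), (RtoC 0), (IZR b, 0). do 4 (split; [auto|]). split; [|do 2 (split; [auto|])].
    + intros d Hd (k1 & Hk1 & D1) _ (k2 & Hk2 & D2). split; auto.
      destruct Hk1 as (x1 & x2 & ->). destruct Hk2 as (y1 & y2 & ->).
      (* The identity 1 = (i a)(- i u) + b v exhibits k as an inverse of the common divisor d; both
         have modulus at least 1. *)
      set (k := (IZR (x2 * u + y1 * v), IZR (- x1 * u + y2 * v)) : C).
      assert (Ek : Cmult d k = RtoC 1).
      { apply IZR_eq in Hbez. rewrite plus_IZR, !mult_IZR in Hbez.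
        replace (RtoC 1) with (Cplus (Cmult (0, IZR a) (0, - IZR u)) (Cmult (IZR b, 0) (IZR v, 0)))
          by (apply injective_projections; simpl; lra).
        rewrite D1, D2. unfold k. rewrite !plus_IZR, !mult_IZR, opp_IZR.
        apply injective_projections; simpl; ring. }
      assert (Em : Cmod d * Cmod k = 1) by (rewrite <- Cmod_mult, Ek; apply Cmod_1).
      assert (Hd1 : 1 <= Cmod d).
      { apply gauss_int_Cmod_ge1; auto. intros ->. rewrite Cmod_0 in Em. lra. }
      assert (Hk1 : 1 <= Cmod k).
      { apply gauss_int_Cmod_ge1; [eexists; eexists; reflexivity|].
        intros E. rewrite E, Cmod_0 in Em. lra. }
      nra.
    + unfold Cmod; simpl fst; simpl snd. replace (IZR b ^ 2 + 0 ^ 2) with (Rsqr (IZR b)) by (unfold Rsqr; ring).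
      now rewrite sqrt_Rsqr by lra.
  - rewrite dCyg_chain. simpl fst; simpl snd. rewrite Cmod_0.
    replace (Cminus (0, IZR a / IZR b) (0, s)) with ((0, IZR a / IZR b - s) : C)
      by (apply injective_projections; simpl; ring).
    rewrite Cmod_imag. unfold gcost.
    replace (2 * Rabs (IZR a / IZR b - s) + 0 ^ 2) with (2 * Rabs (IZR a / IZR b - s)) by ring.
    replace (IZR b * s - IZR a) with (IZR b * - (IZR a / IZR b - s)) by (field; lra).
    rewrite Rabs_mult, Rabs_Ropp, (Rabs_pos_eq (IZR b)) by lra.
    replace (2 * (IZR b * (IZR b * Rabs (IZR a / IZR b - s))))
      with ((IZR b)² * (2 * Rabs (IZR a / IZR b - s))) by (unfold Rsqr; ring).
    rewrite (sqrt_mult_alt (IZR b)²), sqrt_Rsqr by (try apply Rle_0_sqr; lra). reflexivity.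
Qed.

Lemma Sp_Lag_of_chain s t : 0 <= t <= 1 ->
  (forall a b : Z, 0 < IZR b -> IZR b * s <> IZR a) ->
  (forall t0, 0 < t0 < t -> exists H, forall a b : Z, H <= IZR b -> 0 < IZR b -> t0 <= gcost s a b) ->
  (forall t1 H, t < t1 -> exists a b u v : Z, (0 < b)%Z /\ H <= IZR b /\
    (a * u + b * v = 1)%Z /\ gcost s a b <= t1) ->
  Sp_Lag t.
Proof.
  intros Ht Hirr Hlow Hup. exists (chain_pt s). split; [|split].
  - unfold in_QR, chain_pt; simpl fst; simpl snd.
    assert (E : Cmod (0, 0) = 0) by exact Cmod_0. rewrite E. simpl. ring.
  - intros (_ & (p & q & (p1 & p2 & ->) & (q1 & q2 & ->) & Hq & E) & _). simpl fst in E.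
    assert (Ep : (IZR p1, IZR p2) = Cmult (0, s) (IZR q1, IZR q2)).
    { rewrite E. unfold Cdiv. now rewrite <- Cmult_assoc, Cinv_l, Cmult_1_r. }
    injection Ep as Ep1 Ep2.
    assert (Hir : forall a b : Z, b <> 0%Z -> IZR b * s <> IZR a).
    { intros a b Hb Eb. destruct (Z_lt_le_dec 0 b) as [H|H].
      - apply (Hirr a b); auto. now apply IZR_lt.
      - apply (Hirr (- a)%Z (- b)%Z); rewrite ?opp_IZR; [|lra].
        assert (b < 0)%Z as H' by lia. apply IZR_lt in H'. lra. }
    destruct (Z.eq_dec q1 0) as [->|H1].
    + destruct (Z.eq_dec q2 0) as [->|H2]; [now apply Hq|].
      apply (Hir (- p1)%Z q2 H2). rewrite opp_IZR. lra.
    + apply (Hir p2 q1 H1). lra.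
  - apply is_lub_Rbar_unique. split.
    (* An infimum y > t would exceed the cost of some approximant of height at least H, which is at
       most (t + y) / 2. *)
    + intros y (H & Hy). apply Rbar_not_lt_le. intros Hlt. simpl in Hlt.
      destruct (Hup ((t + y) / 2) H) as (a & b & u & v & Hb & HH & Hbez & Hc); [lra|].
      destruct (chain_approximant s a b u v Hb Hbez) as (r & Hr1 & Hr2 & Hr3).
      assert (Hg := proj1 (Glb_Rbar_correct (fun w : R => exists r hr,
        in_QQ r /\ height r hr /\ H <= hr /\ w = hr * dCyg (chain_pt s) r))).
      rewrite <- Hy in Hg. specialize (Hg (gcost s a b)). simpl in Hg.
      assert (y <= gcost s a b) by (apply Hg; exists r, (IZR b); auto). lra.
    + intros l Hl. apply Rbar_not_lt_le. intros Hlt.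
      assert (Hkey : forall t0, t0 < t -> Rbar_le t0 l).
      { intros t0 Ht0.
        assert (Hex : exists H, forall r hr, in_QQ r -> height r hr -> H <= hr ->
          t0 <= hr * dCyg (chain_pt s) r).
        { destruct (Rle_dec t0 0) as [Hn|Hn].
          - exists 0. intros r hr Hr Hh _. pose proof (height_ge1 _ _ Hh).
            assert (0 <= dCyg (chain_pt s) r) by apply sqrt_pos. nra.
          - destruct (Hlow t0) as [H HH]; [lra|]. exists (2 * Rmax H 1).
            intros r hr Hr Hh Hge. apply chain_lower with H; auto. lra. }
        destruct Hex as [H HH].
        pose (S := fun w : R => exists r hr,
          in_QQ r /\ height r hr /\ H <= hr /\ w = hr * dCyg (chain_pt s) r).
        destruct (Glb_Rbar_correct S) as [G1 G2].
        assert (L0 : Rbar_le t0 (Glb_Rbar S)).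
        { apply G2. intros w (r & hr & Hr & Hh & Hge & ->). simpl. now apply HH. }
        (* Only finite infima enter the supremum; an actual approximant beyond H excludes the value
           plus infinity. *)
        destruct (Hup (t + 1) H) as (a & b & u & v & Hb & HH' & Hbez & Hc); [lra|].
        destruct (chain_approximant s a b u v Hb Hbez) as (r & Hr1 & Hr2 & Hr3).
        assert (L1 : Rbar_le (Glb_Rbar S) (gcost s a b)).
        { apply G1. exists r, (IZR b). auto. }
        destruct (Glb_Rbar S) as [g| |] eqn:EG; try (simpl in *; tauto).
        apply Rbar_le_trans with g; auto. apply Hl. exists H. rewrite <- EG. reflexivity. }
      destruct l as [l| |]; simpl in Hlt; try tauto.
      * specialize (Hkey ((l + t) / 2)). simpl in Hkey. lra.
      * specialize (Hkey (t - 1)). simpl in Hkey. apply Hkey. lra.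
Qed.

(** * From digit sequences to the Lagrange spectrum *)

Lemma cont_bezout w : exists u v : Z,
  (fst (cont (0, 1) w) * u + fst (cont (1, 0) w) * v = 1)%Z.
Proof.
  assert (Hd := det_unit w). unfold num, num', den, den' in Hd.
  rewrite <- !mult_IZR, <- minus_IZR, <- abs_IZR in Hd. apply eq_IZR in Hd. revert Hd.
  generalize (fst (cont (0, 1)%Z w)) (snd (cont (0, 1)%Z w))
    (fst (cont (1, 0)%Z w)) (snd (cont (1, 0)%Z w)). intros x x' y y' Hd.
  set (d := (x' * y - x * y')%Z) in *. assert (Hdd : (d * d = 1)%Z) by nia.
  exists (- d * y')%Z, (d * x')%Z. rewrite <- Hdd. unfold d. ring.
Qed.

(** At the convergent with n digits [gcost] is sqrt (2 / [quality a n]), and a denominator between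
    two consecutive ones does no better than the smaller. The two bounds thus say that 2 / t^2 is
    the limsup of the qualities. *)
Lemma Sp_Lag_of_digits a t : (forall i, 1 <= a i)%Z -> 0 <= t <= 1 ->
  (forall t0, 0 < t0 < t -> exists N, forall n, (N <= n)%nat -> quality a n <= 2 / t0 ^ 2) ->
  (forall t1 N, t < t1 -> exists n, (N <= n)%nat /\ 2 / t1 ^ 2 <= quality a n) ->
  Sp_Lag t.
Proof.
  intros Ha Ht Hlow Hup. apply (Sp_Lag_of_chain (tail a 0)); auto.
  (* A rational value would force some convergent to have error zero. *)
  - intros p b Hb E. assert (Hb1 : 1 <= IZR b) by (apply lt_IZR in Hb; apply IZR_le; lia).
    destruct (den_hist_bracket a (IZR b) Ha Hb1) as [n Hn].
    assert (H := best_approximation a n b p Ha ltac:(lra)).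
    rewrite E, Rminus_diag, Rabs_R0 in H. pose proof (err_abs_gt0 a n Ha). lra.
  - intros t0 Ht0. destruct (Hlow t0 Ht0) as [N HN]. exists (den (hist a N)). intros p b Hb Hb0.
    destruct (den_bounds _ (hist_pos a N Ha)) as [HN1 _].
    destruct (den_hist_bracket a (IZR b) Ha ltac:(lra)) as [n Hn].
    assert (HNn : (N <= n)%nat).
    { apply Nat.nlt_ge. intros Hlt. pose proof (den_hist_mono a (S n) N Ha Hlt). lra. }
    assert (H := best_approximation a n b p Ha ltac:(lra)).
    specialize (HN n HNn). pose proof (quality_pos a n Ha). pose proof (den_err a n Ha) as He.
    destruct (den_bounds _ (hist_pos a n Ha)) as [Hn1 _].
    assert (Hl : den (hist a n) * Rabs (err a n) <= IZR b * Rabs (IZR b * tail a 0 - IZR p))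
      by (apply Rmult_le_compat; try lra; apply Rabs_pos).
    rewrite He in Hl.
    assert (Ht2 : 0 < t0 ^ 2) by nra.
    assert (Hi : / (2 / t0 ^ 2) <= / quality a n) by (apply Rinv_le_contravar; lra).
    replace (/ (2 / t0 ^ 2)) with (t0 ^ 2 / 2) in Hi by (field; lra).
    unfold gcost. rewrite <- (sqrt_Rsqr t0) by lra. apply sqrt_le_1_alt. unfold Rsqr. lra.
  - intros t1 H Ht1. destruct (INR_archimed 1 H) as [N HN]; [lra|].
    destruct (Hup t1 N Ht1) as (n & Hn & Hq).
    destruct (cont_bezout (hist a n)) as (u & v & Huv).
    exists (fst (cont (0, 1) (hist a n)))%Z, (fst (cont (1, 0) (hist a n)))%Z, u, v.
    pose proof (hist_pos a n Ha) as Hp. destruct (den_bounds _ Hp) as [Hn1 _].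
    destruct (den_ge_length _ Hp) as [Hl _]. rewrite hist_length in Hl. apply le_INR in Hn.
    split; [|split; [|split; [exact Huv|]]].
    + apply lt_IZR. change (0 < den (hist a n)). lra.
    + change (H <= den (hist a n)). lra.
    + unfold gcost. change (sqrt (2 * (den (hist a n) * Rabs (err a n))) <= t1).
      rewrite den_err by auto. rewrite <- (sqrt_Rsqr t1) by lra. apply sqrt_le_1_alt.
      assert (Ht2 : 0 < t1 ^ 2) by nra. assert (0 < 2 / t1 ^ 2) by (apply Rdiv_lt_0_compat; lra).
      apply Rinv_le_contravar in Hq; [|lra].
      replace (/ (2 / t1 ^ 2)) with (t1 ^ 2 / 2) in Hq by (field; lra). unfold Rsqr. lra.
Qed.

(** The digits 1, 2, 3, ... are unbounded, so the qualities are too; the lower bound is vacuous for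
    t = 0. *)
Lemma Sp_Lag_0 : Sp_Lag 0.
Proof.
  assert (Ha : forall i, (1 <= Z.of_nat i + 1)%Z) by lia.
  apply (Sp_Lag_of_digits (fun n => Z.of_nat n + 1)%Z); auto; [lra | intros; lra |].
  intros t1 N Ht1. destruct (INR_archimed 1 (2 / t1 ^ 2)) as [K HK]; [lra|].
  exists (Nat.max N K). split; [lia|]. unfold quality.
  pose proof (tail_pos (fun n => Z.of_nat n + 1)%Z (S (Nat.max N K)) Ha).
  pose proof (ev_nonneg _ 0 (hist_pos (fun n => Z.of_nat n + 1)%Z (Nat.max N K) Ha) (Rle_refl 0)).
  rewrite plus_IZR, <- INR_IZR_INZ.
  assert (INR K <= INR (Nat.max N K)) by (apply le_INR; lia). lra.
Qed.

(** * Digit sequences with prescribed limit superior *)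

(* Most recent digit first, as in [hist]: hence [X j] is reversed and [Y j] is not. *)
Fixpoint splice (m : Z) (X Y : nat -> list Z) (k : nat) : list Z :=
  match k with
  | O => []
  | S j => rev (X j) ++ m :: Y j ++ splice m X Y j
  end.

(** By [splice_length], n + 1 blocks contain position n, so the default 1 is never read; later
    blocks do not alter earlier digits. *)
Definition spliced (m : Z) (X Y : nat -> list Z) (n : nat) : Z :=
  nth n (rev (splice m X Y (S n))) 1%Z.

Lemma splice_length m X Y k : (k <= length (splice m X Y k))%nat.
Proof. induction k; simpl; auto. rewrite !length_app. simpl. rewrite length_app. lia. Qed.

Lemma splice_extend m X Y k k' : (k <= k')%nat ->
  exists l, splice m X Y k' = l ++ splice m X Y k.
Proof.
  induction 1 as [|k' _ [l IH]]; [now exists []|].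
  exists (rev (X k') ++ m :: Y k' ++ l). simpl. rewrite IH, <- !app_assoc. simpl.
  now rewrite <- app_assoc.
Qed.

Lemma spliced_nth m X Y k n : (n < length (splice m X Y k))%nat ->
  nth n (rev (splice m X Y k)) 1%Z = spliced m X Y n.
Proof.
  intros Hn. unfold spliced. pose proof (splice_length m X Y (S n)).
  destruct (Nat.le_ge_cases k (S n)) as [H1|H1];
    destruct (splice_extend m X Y _ _ H1) as [l E]; rewrite E, rev_app_distr, app_nth1; auto;
    rewrite length_rev; lia.
Qed.

Lemma hist_of_nth a l : (forall n, (n < length l)%nat -> nth n (rev l) 1%Z = a n) ->
  hist a (length l) = l.
Proof.
  induction l as [|d l IH]; intros H; auto. simpl. f_equal.
  - rewrite <- H by (simpl; lia). simpl. rewrite app_nth2 by (rewrite length_rev; lia).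
    now rewrite length_rev, Nat.sub_diag.
  - apply IH. intros n Hn. rewrite <- H by (simpl; lia). simpl.
    rewrite app_nth1; auto. rewrite length_rev; lia.
Qed.

(** Dropping the most recent digits of a splice leaves an initial segment of the sequence. *)
Lemma hist_spliced m X Y k l l' : splice m X Y k = l ++ l' ->
  hist (spliced m X Y) (length l') = l'.
Proof.
  intros E. apply hist_of_nth. intros n Hn.
  rewrite <- (spliced_nth m X Y k n) by (rewrite E, length_app; lia).
  rewrite E, rev_app_distr, app_nth1; auto. rewrite length_rev; lia.
Qed.

Lemma spliced_pos m X Y i : (1 <= m)%Z -> (forall k, digits (X k)) -> (forall k, digits (Y k)) ->
  (1 <= spliced m X Y i)%Z.
Proof.
  intros Hm HX HY.
  assert (H : forall k, all_pos (splice m X Y k)).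
  { induction k; simpl; [constructor|]. apply Forall_app. split.
    - apply Forall_rev, digits_all_pos, HX.
    - constructor; auto. apply Forall_app. split; auto. apply digits_all_pos, HY. }
  unfold spliced. destruct (nth_in_or_default i (rev (splice m X Y (S i))) 1%Z) as [Hi|Hi].
  - apply in_rev in Hi. specialize (H (S i)). apply Forall_forall with (1 := H); auto.
  - rewrite Hi. lia.
Qed.

Lemma quality_centre m X Y k : (1 <= m)%Z -> (forall k, digits (X k)) -> (forall k, digits (Y k)) ->
  exists x y, 0 <= x <= 1 /\ 0 <= y <= 1 /\
  quality (spliced m X Y) (length (Y k ++ splice m X Y k)) = IZR m + ev (X k) x + ev (Y k) y.
Proof.
  intros Hm HX HY. set (a := spliced m X Y). set (h := splice m X Y k).
  set (n := length (Y k ++ h)).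
  assert (Ha : forall i, (1 <= a i)%Z) by (intros i; now apply spliced_pos).
  assert (E1 : hist a n = Y k ++ h).
  { apply (hist_spliced m X Y (S k) (rev (X k) ++ [m])). simpl. now rewrite <- app_assoc. }
  assert (E2 : hist a (S n) = m :: Y k ++ h).
  { apply (hist_spliced m X Y (S k) (rev (X k)) (m :: Y k ++ h)). reflexivity. }
  assert (E3 : hist a (length (splice m X Y (S k))) = splice m X Y (S k)).
  { now apply (hist_spliced m X Y (S k) []). }
  (* Reversing the history at the end of the block puts the digits in order; removing those up to
     [m] leaves [X k]. *)
  assert (E4 : fwd a (S n) (length (X k)) = X k).
  { apply (f_equal (@rev Z)) in E3. rewrite rev_hist in E3.
    change (splice m X Y (S k)) with (rev (X k) ++ (m :: Y k ++ h)) in E3.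
    replace (length (rev (X k) ++ (m :: Y k ++ h))) with (S n + length (X k))%nat in E3
      by (rewrite length_app, length_rev; simpl length; fold n; lia).
    rewrite fwd_app, <- rev_hist, E2 in E3. simpl Nat.add in E3.
    rewrite rev_app_distr, rev_involutive in E3. now apply app_inv_head in E3. }
  exists (tail a (S n + length (X k))), (ev h 0).
  split; [now apply tail_bounds|]. split.
  - apply ev_le1; [|lra]. assert (Hp := hist_pos a n Ha). rewrite E1 in Hp.
    now apply Forall_app in Hp.
  - unfold quality. rewrite E1, ev_app, (tail_ev a (S n) (length (X k)) Ha), E4.
    simpl hist in E2. injection E2 as Em _. now rewrite Em.
Qed.

(** Position n falls into some block k >= K: before the centre it reads [Y k], after it [X k]. *)
Lemma spliced_cases m X Y K n : (forall k, digits (X k)) -> (forall k, digits (Y k)) ->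
  (length (splice m X Y K) <= n)%nat ->
  (spliced m X Y n <= 10)%Z \/
  exists k, (K <= k)%nat /\ n = length (Y k ++ splice m X Y k).
Proof.
  intros HX HY HK.
  assert (Hk : exists k, (length (splice m X Y k) <= n < length (splice m X Y (S k)))%nat).
  { pose proof (splice_length m X Y (S n)) as Hl.
    assert (Hl' : (n < length (splice m X Y (S n)))%nat) by lia. clear Hl. revert Hl'.
    generalize (S n). induction n0 as [|j IH]; intros Hl'; [simpl in Hl'; lia|].
    destruct (Nat.le_gt_cases (length (splice m X Y j)) n) as [H|H]; [now exists j | auto]. }
  destruct Hk as [k [H1 H2]].
  assert (HKk : (K <= k)%nat).
  { apply Nat.nlt_ge. intros H. destruct (splice_extend m X Y (S k) K H) as [l E].
    rewrite E, length_app in HK. lia. }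
  rewrite <- (spliced_nth m X Y (S k) n H2). simpl splice in *.
  rewrite rev_app_distr, rev_involutive. simpl rev. rewrite rev_app_distr, <- !app_assoc.
  rewrite app_nth2 by (rewrite length_rev; lia). rewrite length_rev.
  rewrite length_app, length_rev in H2. simpl in H2. rewrite length_app in H2.
  assert (Hdig : forall l i, digits l -> (i < length l)%nat -> (nth i l 1 <= 10)%Z).
  { intros l i Hl Hi.
    exact (proj2 (proj1 (Forall_forall _ l) Hl _ (nth_In l 1%Z Hi))). }
  destruct (Nat.lt_trichotomy n (length (Y k ++ splice m X Y k))) as [H|[H|H]];
    [left | right; exists k; auto | left]; rewrite length_app in H.
  - rewrite app_nth1 by (rewrite length_rev; lia). apply Hdig; [apply Forall_rev, HY|].
    rewrite length_rev. lia.
  - rewrite app_nth2 by (rewrite length_rev; lia). rewrite length_rev.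
    rewrite app_nth2 by (simpl; lia). apply Hdig; [apply HX|]. simpl. lia.
Qed.

Lemma quality_small a n : (forall i, 1 <= a i)%Z -> (a n <= 10)%Z -> quality a n <= 12.
Proof.
  intros Ha Hn. apply IZR_le in Hn. unfold quality. pose proof (tail_lt1 a (S n) Ha).
  pose proof (ev_le1 _ 0 (hist_pos a n Ha) ltac:(lra)). lra.
Qed.

Theorem theorem1p8 : forall t : R, 0 <= t <= 47 / 1000 -> Sp_Lag t.
Proof.
  intros t [[Ht|<-] Ht1]; [|exact Sp_Lag_0].
  pose proof alpha_bounds as Hal. pose proof beta_bounds as Hbe.
  set (M := 2 / t ^ 2).
  assert (Hanti : forall x y, 0 < x < y -> 2 / y ^ 2 < 2 / x ^ 2).
  { intros x y Hxy. unfold Rdiv. apply Rmult_lt_compat_l; [lra|].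
    apply Rinv_lt_contravar; [apply Rmult_lt_0_compat|]; nra. }
  (* A crude bound, as 2 / (1/4)^2 = 32; it makes M exceed the 12 of the positions off the centres
     and [m] positive. *)
  assert (HM : 13 < M).
  { unfold M. apply Rlt_trans with (2 / (1 / 4) ^ 2); [lra|]. apply Hanti. lra. }
  (* This puts M - m between 2 beta - 1 and 2 beta, inside Hall's interval because 2 beta - 1 > 2
     alpha. *)
  set (m := up (M - 2 * beta)).
  destruct (archimed (M - 2 * beta)) as [Hm1 Hm2]. fold m in Hm1, Hm2.
  assert (Hm : (1 <= m)%Z) by (apply le_IZR; lra).
  assert (Hch : exists XY : nat -> list Z * list Z, forall k,
    digits (fst (XY k)) /\ digits (snd (XY k)) /\ forall x y, 0 <= x <= 1 -> 0 <= y <= 1 ->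
    Rabs (ev (fst (XY k)) x + ev (snd (XY k)) y - (M - IZR m)) <= / INR (S k)).
  { apply functional_choice with (R := fun k XY => digits (fst XY) /\ digits (snd XY) /\
      forall x y, 0 <= x <= 1 -> 0 <= y <= 1 ->
      Rabs (ev (fst XY) x + ev (snd XY) y - (M - IZR m)) <= / INR (S k)).
    intros k. destruct (hall_sum (M - IZR m) (/ INR (S k))) as (X & Y & H); [lra| |].
    - apply Rinv_0_lt_compat, lt_0_INR. lia.
    - now exists (X, Y). }
  destruct Hch as [XY HXY].
  set (X k := fst (XY k)). set (Y k := snd (XY k)).
  assert (HX : forall k, digits (X k)) by (intros k; apply HXY).
  assert (HY : forall k, digits (Y k)) by (intros k; apply HXY).
  set (a := spliced m X Y).
  assert (Ha : forall i, (1 <= a i)%Z) by (intros i; now apply spliced_pos).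
  assert (Hq : forall k, Rabs (quality a (length (Y k ++ splice m X Y k)) - M) <= / INR (S k)).
  { intros k. destruct (quality_centre m X Y k Hm HX HY) as (x & y & Hx & Hy & E).
    unfold a. rewrite E. destruct (HXY k) as (_ & _ & H). specialize (H x y Hx Hy).
    fold (X k) (Y k) in H.
    replace (IZR m + ev (X k) x + ev (Y k) y - M)
      with (ev (X k) x + ev (Y k) y - (M - IZR m)) by ring. exact H. }
  assert (Hinv : forall eps, 0 < eps -> exists K, forall k, (K <= k)%nat -> / INR (S k) < eps).
  { intros eps He. destruct (INR_archimed eps 1 He) as [K HK]. exists K. intros k Hk.
    apply le_INR in Hk. rewrite S_INR. pose proof (pos_INR K).
    apply Rmult_lt_reg_r with (INR k + 1); [lra|]. rewrite Rinv_l by lra. nra. }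
  apply (Sp_Lag_of_digits a); auto; [lra| |].
  - intros t0 Ht0. assert (HM0 : M < 2 / t0 ^ 2) by (apply Hanti; lra).
    destruct (Hinv (2 / t0 ^ 2 - M)) as [K HK]; [lra|].
    exists (length (splice m X Y K)). intros n Hn.
    destruct (spliced_cases m X Y K n HX HY Hn) as [H|(k & Hk & ->)].
    + pose proof (quality_small a n Ha H). lra.
    + specialize (Hq k). specialize (HK k Hk). apply Rabs_le_between in Hq. lra.
  - intros t1 N Ht1'. assert (HM0 : 2 / t1 ^ 2 < M) by (apply Hanti; lra).
    destruct (Hinv (M - 2 / t1 ^ 2)) as [K HK]; [lra|].
    (* Every block has at least one digit, so the centre of block k >= N lies at a position at least
       N. *)
    set (k := Nat.max N K). exists (length (Y k ++ splice m X Y k)). split.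
    + rewrite length_app. pose proof (splice_length m X Y k). lia.
    + specialize (Hq k). specialize (HK k ltac:(lia)). apply Rabs_le_between in Hq. lra.
Qed.
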